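(* Every restrictive Calderón–Zygmund space is a Calderón–Zygmund space.
   Context: A quasi-partition of a measurable set $E$ in a measure space is an at most countable family $\mathcal P$ of pairwise disjoint measurable subsets of $E$ such that $E\setminus\bigcup\mathcal P$ is negligible. $B_X(x,r)$ is the open ball of centre $x$ and radius $r$. Restrictive Calderón–Zygmund space: a metric-measure space $(X,d,\mu)$, $\mu$ a Radon measure, equipped with a family $\mathscr R$ of Borel subsets of $X$ (admissible sets) such that, for some $\kappa\in[1,\infty)$: (1) every $R\in\mathscr R$ has a centre $x(R)\in X$ and a radius $r(R)>0$ with $R\subseteq B_X(x(R),\kappa r(R))$; (2) $0<\mu(R^* )\le\kappa\mu(R)<\infty$ for all $R\in\mathscr R$, where $R^*=\{x\in X: d(x,R)<r(R)\}$; (3) to each $R\in\mathscr R$ is associated a collection $\mathscr C(R)\subseteq\mathscr R$ of children of $R$, which is a quasi-partition of $R$ with $\#\mathscr C(R)\le\kappa$ and $\mu(R)\le\kappa\mu(R')$ for all $R'\in\mathscr C(R)$; set $\mathscr C^0(R)=\{R\}$, $\mathscr C^{n+1}(R)=\bigcup_{R'\in\mathscr C^n(R)}\mathscr C(R')$, and call the elements of $\bigcup_{n\in\mathbb N}\mathscr C^n(R)$ descendants of $R$; (4) for all $\varepsilon>0$ and $R\in\mathscr R$, and almost all $x\in R$, there is a descendant $R'$ of $R$ with $x\in R'$ and $r(R')\le\varepsilon$; (5) for all $\lambda\in(0,\mu(X))$ there is a quasi-partition $\mathcal P\subseteq\mathscr R$ of $X$ with $\mu(R)>\lambda$ for all $R\in\mathcal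 P$. Calderón–Zygmund space: a metric-measure space $(X,d,\mu)$ for which there exist a constant $\kappa\in[1,\infty)$ and a family $\mathscr R$ of Borel subsets of $X$ such that (i) for all $R\in\mathscr R$ there exist $x(R)\in X$ and $r(R)>0$ with $R\subseteq B_X(x(R),\kappa r(R))$; (ii) $\mu(R^* )\le\kappa\mu(R)$ for all $R\in\mathscr R$, where $R^*=\{x\in X:d(x,R)<r(R)\}$; and moreover, for all $f\in L^1(X)$ and $\lambda>\kappa\|f\|_{L^1(X)}/\mu(X)$ ($\lambda>0$ if $\mu(X)=\infty$), there is a decomposition $f=g+\sum_{i\in I}b_i$, with $I$ an at most countable (possibly empty) index set, such that (iii) $\|g\|_{L^\infty(X)}\le\lambda$; (iv) $\int_Xb_i\,d\mu=0$ for all $i\in I$, and $\sum_{i\in I}\|b_i\|_{L^1(X)}\le2\kappa\|f\|_{L^1(X)}$; (v) there is a family $\{R_i\}_{i\in I}\subseteq\mathscr R$ such that $b_i$ is supported in (i.e. vanishes outside) $R_i$, and $\sum_{i\in I}\mu(R_i)\le\kappa\|f\|_{L^1(X)}/\lambda$; (vi) if $f\in L^p(X)$ for some $p\in[1,\infty)$, then $g,b_i\in L^p(X)$ too and the sum $g+\sum_ib_i$ converges to $f$ in $L^p(X)$. *)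

(* Defs.v *)
From HB Require Import structures.
From mathcomp Require Import all_boot all_order all_algebra finmap.
From mathcomp Require Import all_classical all_reals all_analysis.
From mathcomp Require summability.
From mathcomp Require Import complex.

Set Implicit Arguments.
Unset Strict Implicit.
Unset Printing Implicit Defensive.
Import Order.TTheory GRing.Theory Num.Theory.
Import numFieldNormedType.Exports.

Local Open Scope classical_set_scope.
Local Open Scope ring_scope.
Local Open Scope ereal_scope.

(* The point is only there because measurable types are pointed. *)
#[short(type="pointedMetricType")]
HB.structure Definition PointedMetric (K : numDomainType) :=
  {M of Pointed M & Metric K M}.

Notation Borel X := (g_sigma_algebraType (@open X)).

Section metric_measure.
Context {R : realType} {X : pointedMetricType R}.
Variable mu : {measure set (Borel X) -> \bar R}.

Definition radon :=
  [/\ forall K : set X, compact K -> mu K < +oo,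
      forall A : set (Borel X), measurable A ->
        mu A = ereal_inf [set mu U | U in [set U : set X | open U /\ A `<=` U]]
    & forall U : set X, open U ->
        mu U = ereal_sup [set mu K | K in [set K : set X | compact K /\ K `<=` U]]].

(* +oo if A is empty *)
Definition dist_set (x : X) (A : set X) : \bar R :=
  ereal_inf [set (mdist x y)%:E | y in A].

Definition enlarge (A : set X) (r : R) : set X :=
  [set x | dist_set x A < r%:E].

Definition quasi_partition (E : set X) (P : set (set X)) :=
  [/\ countable P,
      trivIset P id,
      forall A, P A -> measurable (A : set (Borel X)) /\ A `<=` E
    & mu.-negligible (E `\` \bigcup_(A in P) A)].

Section descendants.
Variable C : set X -> set (set X).

Fixpoint generation (n : nat) (A : set X) : set (set X) :=
  if n is m.+1 then \bigcup_(B in generation m A) C B else [set A].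

Definition descendants (A : set X) : set (set X) :=
  \bigcup_n generation n A.

End descendants.

(* centre, radius and children are functions on all sets; only their values on
   the family F matter *)
Record restrictive_CZ_axioms (kappa : R) (F : set (set X))
    (centre : set X -> X) (radius : set X -> R)
    (children : set X -> set (set X)) : Prop := {
  rCZ_kappa : (1 <= kappa)%R ;
  rCZ_borel : forall A, F A -> measurable (A : set (Borel X)) ;
  rCZ_radius : forall A, F A -> (0 < radius A)%R ;
  rCZ_ball : forall A, F A -> A `<=` ball (centre A) (kappa * radius A)%R ;
  rCZ_doubling : forall A, F A ->
    [/\ 0 < mu (enlarge A (radius A)),
        mu (enlarge A (radius A)) <= kappa%:E * mu A
      & kappa%:E * mu A < +oo] ;
  rCZ_children_sub : forall A, F A -> children A `<=` F ;
  rCZ_children_partition : forall A, F A -> quasi_partition A (children A) ;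
  rCZ_children_card : forall A, F A ->
    finite_set (children A) /\ (#|` fset_set (children A)|%:R <= kappa)%R ;
  rCZ_children_measure : forall A, F A -> forall B, children A B ->
    mu A <= kappa%:E * mu B ;
  rCZ_descendants : forall (eps : R) A, (0 < eps)%R -> F A ->
    {ae mu, forall x, A x ->
      exists B, [/\ descendants children A B, B x & (radius B <= eps)%R]} ;
  rCZ_partition : forall l : R, (0 < l)%R -> l%:E < mu [set: X] ->
    exists P, [/\ P `<=` F, quasi_partition [set: X] P
                & forall A, P A -> l%:E < mu A]
}.

Definition restrictive_CZ_space :=
  radon /\ exists kappa F centre radius children,
    restrictive_CZ_axioms kappa F centre radius children.

Definition Lpnorm (p : \bar R) (f : X -> R[i]) : \bar R :=
  Lnorm mu p (fun x : Borel X => (Normc.normc (f x))%:E).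

(* A function to R[i] is Borel measurable iff its real and imaginary parts are. *)
Definition in_Lp (p : \bar R) (f : X -> R[i]) :=
  [/\ measurable_fun [set: Borel X] (fun x : Borel X => complex.Re (f x)),
      measurable_fun [set: Borel X] (fun x : Borel X => complex.Im (f x))
    & Lpnorm p f < +oo].

(* The error after the finite partial sum over J. Convergence of g + \sum_i b i
   to f is taken along the net of finite sets J of indices (summability.totally)
   so that it does not depend on an enumeration of I. *)
Definition sum_error (I : countType) (f g : X -> R[i]) (b : I -> X -> R[i])
    (J : {fset I}) (x : X) : R[i] :=
  (f x - (g x + \sum_(i <- J) b i x))%R.

Definition CZ_decomposition (kappa : R) (F : set (set X)) (f : X -> R[i])
    (l : R) :=
  exists (I : countType) (g : X -> R[i]) (b : I -> X -> R[i])
         (A : I -> set X),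
    [/\ {ae mu, forall x,
          (Normc.normc (sum_error f g b J x)
             @[J --> summability.totally] --> (0 : R))%R},
        Lpnorm +oo g <= l%:E,
        (forall i, \int[mu]_x (complex.Re (b i x))%:E = 0 /\
                   \int[mu]_x (complex.Im (b i x))%:E = 0) /\
        \esum_(i in [set: I]) Lpnorm 1 (b i) <= (2 * kappa)%:E * Lpnorm 1 f,
        [/\ forall i, F (A i),
            forall i x, ~ A i x -> b i x = 0%R
          & \esum_(i in [set: I]) mu (A i) <= kappa%:E * Lpnorm 1 f / l%:E]
      & forall p : R, (1 <= p)%R -> in_Lp p%:E f ->
          [/\ in_Lp p%:E g,
              forall i, in_Lp p%:E (b i)
            & Lpnorm p%:E (sum_error f g b J)
                @[J --> summability.totally] --> 0]].

(* In \bar R, x / +oo = 0, so that the condition on l is 0 < l if mu X = +oo;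
   it is also 0 < l in the degenerate case mu X = 0, where Lpnorm 1 f = 0 and
   0 / 0 = 0. *)
Record CZ_axioms (kappa : R) (F : set (set X))
    (centre : set X -> X) (radius : set X -> R) : Prop := {
  CZ_kappa : (1 <= kappa)%R ;
  CZ_borel : forall A, F A -> measurable (A : set (Borel X)) ;
  CZ_radius : forall A, F A -> (0 < radius A)%R ;
  CZ_ball : forall A, F A -> A `<=` ball (centre A) (kappa * radius A)%R ;
  CZ_doubling : forall A, F A ->
    mu (enlarge A (radius A)) <= kappa%:E * mu A ;
  CZ_decomp : forall (f : X -> R[i]) (l : R), in_Lp 1 f ->
    kappa%:E * Lpnorm 1 f / mu [set: X] < l%:E ->
    CZ_decomposition kappa F f l
}.

Definition CZ_space :=
  radon /\ exists kappa F centre radius, CZ_axioms kappa F centre radius.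

End metric_measure.

(* Main.v *)
Require Import Defs.
From mathcomp Require Import all_boot all_order all_algebra finmap.
From mathcomp Require Import all_classical all_reals all_analysis.
From mathcomp Require Import measurable_realfun ess_sup_inf.
From mathcomp Require Import ring lra.
From mathcomp Require summability.
From mathcomp Require Import complex.

(** The decomposition is the classical stopping-time one, with the same constant
    [kappa], the same family [F] and the threshold [a = l / kappa].

    If the norm of [f] is positive, the last axiom of a restrictive space,
    applied at [kappa * ||f|| / l], gives a quasi-partition [P] of [X] on whose
    members the mean of [|f|] is at most [a].  Descend from [P] through the
    children and stop at the first sets whose mean of [|f|] exceeds [a].  The
    stopped sets are pairwise disjoint, and their means lie between [a] and
    [kappa * a = l], because the parent of a stopped set did not stop and is at
    most [kappa] times larger ([stopped_mean_le]).

    Off the stopped sets [|f| <= a] almost everywhere, by outer regularity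
    ([ae_le_of_light_cover]).  Let [E] be the set of points off the stopped sets
    where [|f| > a], and [U] an open set containing [E].  Almost every point of
    [E] has descendants around it that are so small that they lie in [U], and
    none of them has a mean above [a].  The first such descendants are disjoint,
    so summing over them gives [\int_E |f| <= a * mu U].  Letting [U] shrink to
    [E] gives [\int_E |f| <= a * mu E], hence [mu E = 0].

    Let [g] be the mean of [f] on each stopped set and [f] elsewhere, and let
    [b_i] be [f - g] on the [i]-th stopped set and [0] elsewhere.  The bounds of
    the decomposition are then sums over disjoint sets.  For the [L^p]
    statements, [|g| <= l] on the union of the stopped sets, which has finite
    measure; so [g] and [f - g] are in [L^p] as soon as [f] is.  The error after
    a finite set [J] of indices is [f - g] cut off to the stopped sets outside
    [J], and its norm tends to [0] because it is the tail of a convergent sum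
    ([integral_tail_small]). *)

Local Open Scope classical_set_scope.
Local Open Scope ring_scope.

Set Implicit Arguments.
Unset Strict Implicit.
Unset Printing Implicit Defensive.
Import Order.TTheory GRing.Theory Num.Theory.
Import numFieldNormedType.Exports.

Local Notation normc := Normc.normc.
Local Notation totally := summability.totally.
#[local] Existing Instance summability.totally_filter.

(** * Stopping in a nested sequence of families of sets *)

Section stopping.
Context {T : Type}.
Implicit Types (G : nat -> set (set T)) (Q : set (set T)) (A B : set T).

Definition nested G :=
  (forall n, trivIset (G n) id) /\
  (forall n B, G n.+1 B -> exists2 A, G n A & B `<=` A).

(** Stopping is decided by the generation, not by maximality for inclusion:
    a set may be its own child and so recur at several levels. *)
Definition stopped G Q : set (set T) :=
  [set B | exists n, [/\ G n B, Q B &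
    forall m A, (m < n)%N -> G m A -> B `<=` A -> ~ Q A]].

Lemma ancestor G m n B : nested G -> (m <= n)%N -> G n B ->
  exists2 A, G m A & B `<=` A.
Proof.
move=> [_ par]; elim: n B => [|n IH] B.
  by rewrite leqn0 => /eqP -> GB; exists B.
rewrite leq_eqVlt => /predU1P[-> GB|]; first by exists B.
rewrite ltnS => /IH{}IH /par[A /IH[A' GA' AA'] BA].
by exists A' => //; exact: subset_trans BA AA'.
Qed.

(** Of two stopped sets that meet, the later one has the earlier one as its
    ancestor at that level, so it would have stopped there. *)
Lemma trivIset_stopped G Q : nested G -> trivIset (stopped G Q) id.
Proof.
move=> nG.
suff aux B B' n m : (m <= n)%N -> G n B -> G m B' -> Q B' ->
    (forall k A, (k < n)%N -> G k A -> B `<=` A -> ~ Q A) ->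
    B `&` B' !=set0 -> B = B'.
  move=> B B' [n [GB QB nB]] [m [GB' QB' nB']] BB'.
  have [mn|/ltnW nm] := leqP m n; first exact: (aux _ _ n m).
  by apply/esym/(aux _ _ m n) => //; rewrite setIC.
move=> mn GB GB' QB' nB [x [Bx B'x]].
have [A GA BA] := ancestor nG mn GB.
have AB' : A = B' by apply: (nG.1 m) => //; exists x; split => //; exact: BA.
rewrite AB' in BA; move: mn; rewrite leq_eqVlt => /predU1P[E|mn].
  by rewrite E in GB'; apply: (nG.1 n) => //; exists x.
by have := nB _ _ mn GB' BA QB'.
Qed.

Lemma stopped_cover G Q n B : G n B -> Q B ->
  exists2 A, stopped G Q A & B `<=` A.
Proof.
move=> GB QB.
pose p k := `[< exists A, [/\ G k A, Q A & B `<=` A] >].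
have [k /asboolP[A [GA QA BA]] kmin] : exists2 k, p k & forall j, p j -> (k <= j)%N.
  have ex : exists k, p k by exists n; apply/asboolP; exists B; split.
  by case: (ex_minnP ex) => k pk kmin; exists k.
exists A => //; exists k; split => // m A' mk GA' AA' QA'.
suff /kmin : p m by rewrite leqNgt mk.
by apply/asboolP; exists A'; split => //; exact: subset_trans BA AA'.
Qed.

Lemma countable_stopped G Q :
  (forall n, countable (G n)) -> countable (stopped G Q).
Proof.
move=> cG; apply: (@sub_countable _ _ _ (\bigcup_n G n)).
  by apply: subset_card_le => B [n [GB _ _]]; exists n.
exact: bigcup_countable.
Qed.

End stopping.

Section levels.
Context {R : realType} {X : pointedMetricType R}.
Implicit Types (C : set X -> set (set X)) (P : set (set X)).

Definition level C P (n : nat) :=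
  \bigcup_(A in P) generation C n A.

Lemma levelS C P n : level C P n.+1 = \bigcup_(A in level C P n) C A.
Proof. by rewrite /level bigcup_bigcup. Qed.

Lemma level0 C P : level C P 0 = P.
Proof.
apply/seteqP; split=> [B [A PA /= ->]//|B PB].
by exists B.
Qed.

End levels.

(** The decomposition is indexed by a [countType], possibly finite or empty,
    while the stopping construction yields a countable set of sets. *)
Lemma countable_index (T : Type) (S : set T) : countable S ->
  exists (I : countType) (A : I -> T), injective A /\ range A = S.
Proof.
rewrite -(eq_countable (card_setT S)) => /Pcountable[I SI].
suff : exists A : I -> T, injective A /\ range A = S by move=> ?; exists I.
case: _ / SI; exists val; split; first exact: val_inj.
by apply/seteqP; split => [x [i _ <-]|x Sx]; [exact: set_valP|exists (SigSub (mem_set Sx))].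
Qed.

(** * Integrals over countable disjoint unions *)

Section esum_integral.
Context d (T : measurableType d) (R : realType) (mu : {measure set T -> \bar R}).
Local Open Scope ereal_scope.
Lemma integral_bigcup_esum (I : countType) (A : I -> set T) (h : T -> \bar R) :
  (forall i, measurable (A i)) -> trivIset setT A ->
  measurable_fun setT h -> (forall x, 0 <= h x) ->
  \int[mu]_(x in \bigcup_i A i) h x = \esum_(i in setT) \int[mu]_(x in A i) h x.
Proof.
move=> mA tA mh h0.
(* [pickle_inv] spreads the sets [A i] over [nat]; all other indices carry [set0]. *)
pose F n := oapp A set0 (pickle_inv n).
have -> : \bigcup_i A i = \bigcup_n F n.
  apply/seteqP; split=> x.
    by move=> [i _ Ax]; exists (choice.pickle i) => //; rewrite /F pickleK_inv.
  by rewrite /F => -[n _]; case: pickle_inv => //= i Ax; exists i.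
rewrite ge0_integral_bigcup//.
- rewrite nneseries_esumT; last by move=> n; exact: integral_ge0.
  rewrite (esumID (range (@choice.pickle I))) ?setTI; last by move=> n _; exact: integral_ge0.
  rewrite [X in _ + X]esum1 ?adde0.
    rewrite esum_image; last by move=> i j _ _; exact: pcan_inj pickleK_inv _ _.
    by apply: eq_esum => i _; rewrite /F pickleK_inv.
  move=> n nI; rewrite /F; case E : pickle_inv => [i|]/=; last exact: integral_set0.
  by exfalso; apply: nI; exists i => //; have := @pickle_invK I n; rewrite E.
- by rewrite /F => n; case: pickle_inv => /=.
- exact: measurable_funTS.
- move=> m n _ _ [x []]; rewrite /F.
  case Em : (pickle_inv m) => [i|]//; case En : (pickle_inv n) => [j|]//= Ai Aj.
  have ij : i = j by apply: tA => //; exists x.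
  by have := @pickle_invK I m; have := @pickle_invK I n; rewrite Em En /= ij => -> ->.
Qed.

End esum_integral.

(** * Functions with small means on a fine family of sets *)

Section density.
Context {R : realType} {X : pointedMetricType R}.
Variable mu : {measure set (Borel X) -> \bar R}.
Local Open Scope ereal_scope.

Lemma open_Borel (U : set X) : open U -> measurable (U : set (Borel X)).
Proof. by move=> oU; apply: sub_sigma_algebra. Qed.

Lemma integral_bigcup_le (I : countType) (A : I -> set (Borel X))
    (phi : Borel X -> R) (a : R) :
  (0 <= a)%R -> (forall i, measurable (A i)) -> trivIset setT A ->
  measurable_fun setT phi -> (forall x, 0 <= phi x)%R ->
  (forall i, \int[mu]_(x in A i) (phi x)%:E <= a%:E * mu (A i)) ->
  \int[mu]_(x in \bigcup_i A i) (phi x)%:E <= a%:E * mu (\bigcup_i A i).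
Proof.
move=> a0 mA tA mphi phi0 h.
have mU : measurable (\bigcup_i A i) by exact: countable_bigcupT_measurable.
rewrite -(integral_cst mu mU a%:E) !integral_bigcup_esum//=.
- by apply: le_esum => i _; rewrite integral_cst.
- exact/measurable_EFinP.
Qed.

(** Stop at the first sets of [G] that lie in an open set [U] and have mean at
    most [a]: these disjoint sets cover almost all of the set [E] where the
    claim fails, so [\int_E phi <= a * mu U].  Outer regularity replaces [U] by
    [E], which is absurd unless [mu E = 0], as [phi > a] on [E]. *)
Lemma ae_le_of_light_cover (G : nat -> set (set X)) (Z : set (Borel X))
    (phi : Borel X -> R) (a : R) :
  radon mu -> (0 < a)%R -> nested G -> (forall n, countable (G n)) ->
  (forall n B, G n B -> measurable (B : set (Borel X))) ->
  measurable Z -> measurable_fun setT phi -> (forall x, 0 <= phi x)%R ->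
  \int[mu]_x (phi x)%:E < +oo ->
  (forall U : set X, open U -> {ae mu, forall x, U x -> ~ Z x ->
     exists n B, [/\ G n B, B x, B `<=` U &
       \int[mu]_(y in B) (phi y)%:E <= a%:E * mu B]}) ->
  {ae mu, forall x, ~ Z x -> (phi x <= a)%R}.
Proof.
move=> [_ outer _] a0 nG cG mG mZ mphi phi0 phioo cov.
have mphiE : measurable_fun setT (EFin \o phi) by exact/measurable_EFinP.
pose E : set (Borel X) := ~` Z `&` phi @^-1` `]a, +oo[.
have mE : measurable E.
  apply: measurableI; first exact: measurableC.
  by rewrite -[X in measurable X]setTI; exact: mphi.
have nuU (U : set X) : open U -> E `<=` U ->
    \int[mu]_(x in E) (phi x)%:E <= a%:E * mu U.
  move=> oU EU.
  pose Q (B : set X) := B `<=` U /\ \int[mu]_(y in (B : set (Borel X))) (phi y)%:E <= a%:E * mu B.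
  have [I [A [Ainj Arng]]] := countable_index (countable_stopped Q cG).
  have SA i : stopped G Q (A i) by rewrite -Arng.
  have mA i : measurable (A i : set (Borel X)).
    by have [n [GA _ _]] := SA i; exact: mG GA.
  have tA : trivIset setT A.
    by move=> i j _ _ ij; apply: Ainj; apply: (trivIset_stopped nG (SA i) (SA j)).
  have mUA : measurable (\bigcup_i A i : set (Borel X)).
    exact: countable_bigcupT_measurable.
  have QA i : Q (A i) by have [n []] := SA i.
  have [N [mN N0 EN]] := cov _ oU.
  apply: (@le_trans _ _ (\int[mu]_(x in \bigcup_i (A i : set (Borel X))) (phi x)%:E)); last first.
    apply: (le_trans (integral_bigcup_le (ltW a0) mA tA mphi phi0 (fun i => (QA i).2))).
    rewrite lee_pmul2l ?lte_fin// ?fin_numE//; apply: le_measure.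
    - exact: mem_set.
    - by apply: mem_set; exact: open_Borel.
    - by move=> x [i _]; exact: (QA i).1.
  rewrite (ge0_negligible_integral mN mE)//; last 2 first.
  - exact: measurable_funTS.
  - by move=> x _; rewrite lee_fin.
  apply: ge0_subset_integral => //.
  - exact: measurableD.
  - exact: measurable_funTS.
  - by move=> x _; rewrite lee_fin.
  move=> x [[Zx phix] Nx].
  have [n [B [GB Bx BU nuB]]] : exists n B, [/\ G n B, B x, B `<=` U &
       \int[mu]_(y in B) (phi y)%:E <= a%:E * mu B].
    apply: contrapT => abs; apply: Nx; apply: EN => /= /(_ _ Zx) H; apply: abs.
    by apply: H; apply: EU.
  have [A' SA' BA'] := stopped_cover GB (conj BU nuB : Q B).
  move: SA'; rewrite -Arng => -[i _ Ai]; exists i => //; rewrite Ai; exact: BA'.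
have phiE_fin : \int[mu]_(x in E) (phi x)%:E < +oo.
  apply: le_lt_trans phioo; apply: ge0_subset_integral => //.
  by move=> x _; rewrite lee_fin.
have aE : a%:E * mu E <= \int[mu]_(x in E) (phi x)%:E.
  rewrite -(integral_cst mu mE a%:E); apply: ge0_le_integral => //.
  - by move=> x _; rewrite lee_fin ltW.
  - exact: measurable_funTS.
  - by move=> x [_]; rewrite /= in_itv/= andbT lee_fin => /ltW.
have nuE : \int[mu]_(x in E) (phi x)%:E <= a%:E * mu E.
  rewrite muleC -lee_pdivrMr//= outer//; apply: le_ereal_inf_tmp => _ [U [oU EU] <-].
  by rewrite lee_pdivrMr// muleC; exact: nuU.
have muE : a%:E * mu E < +oo by exact: le_lt_trans aE phiE_fin.
have h0 x : E x -> 0 <= (phi x - a)%:E.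
  by move=> [_]; rewrite /= in_itv/= andbT lee_fin subr_ge0 => /ltW.
have mh : measurable_fun E (fun x => (phi x - a)%:E).
  by apply: measurable_funTS; apply/measurable_EFinP; apply: measurable_funB.
have : \int[mu]_(x in E) (phi x)%:E = \int[mu]_(x in E) (phi x - a)%:E + a%:E * mu E.
  rewrite -(integral_cst mu mE a%:E) -ge0_integralD//.
  - by apply: eq_integral => x _; rewrite /= -EFinD subrK.
  - by move=> x _; rewrite lee_fin ltW.
move=> nuED.
have hE0 : \int[mu]_(x in E) (phi x - a)%:E = 0.
  apply/eqP; rewrite eq_le integral_ge0// andbT.
  rewrite -(@leeD2rE _ (a%:E * mu E)) ?add0e -?nuED//.
  by rewrite ge0_fin_numE// mule_ge0// lee_fin ltW.
have : ae_eq mu E (fun x => (phi x - a)%:E) (cst 0).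
  apply/ae_eq_integral_abs => //; rewrite -[RHS]hE0; apply: eq_integral => x.
  by move=> /set_mem Ex; rewrite gee0_abs//; exact: h0.
apply: filterS => x Eh Zx; rewrite leNgt; apply/negP => ax.
have Ex : E x by split => //; rewrite /= in_itv/= andbT.
have /= [/eqP] := Eh Ex; rewrite subr_eq0 => /eqP phia.
by rewrite phia ltxx in ax.
Qed.

End density.

(** * The stopped sets of a restrictive space *)

Lemma ae_forall_countable d (T : measurableType d) (R : realType)
    (mu : {measure set T -> \bar R}) (I : Type) (S : set I) (Q : I -> T -> Prop) :
  countable S -> (forall i, S i -> {ae mu, forall x, Q i x}) ->
  {ae mu, forall x, forall i, S i -> Q i x}.
Proof.
move=> /countable_index[J [e [einj eS]]] h.
have : {ae mu, forall x, forall n, oapp (fun j => Q (e j) x) True (pickle_inv n)}.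
  apply/ae_foralln => n; case: pickle_inv => [j|] /=; last exact: nearW.
  by apply: h; rewrite -eS.
apply: filterS => x hx i; rewrite -eS => -[j _ <-].
by have := hx (choice.pickle j); rewrite pickleK_inv.
Qed.

Section selection.
Context {R : realType} {X : pointedMetricType R}.
Variable mu : {measure set (Borel X) -> \bar R}.
Variables (kappa : R) (F : set (set X)) (centre : set X -> X)
  (radius : set X -> R) (children : set X -> set (set X)).
Hypothesis HX : restrictive_CZ_axioms mu kappa F centre radius children.
Local Open Scope ereal_scope.

Let kappa_gt0 : (0 < kappa)%R.
Proof. exact: lt_le_trans ltr01 (rCZ_kappa HX). Qed.

Lemma admissible_fin (A : set X) : F A -> mu A < +oo.
Proof.
move=> FA; have [_ _] := rCZ_doubling HX FA; apply: le_lt_trans.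
by rewrite lee_pemull// lee_fin (rCZ_kappa HX).
Qed.

Lemma admissible_gt0 (A : set X) : F A -> 0 < mu A.
Proof.
move=> FA; have [p q _] := rCZ_doubling HX FA.
by have := lt_le_trans p q; rewrite pmule_rgt0.
Qed.

Variable P : set (set X).
Hypothesis PF : P `<=` F.
Hypothesis Pq : quasi_partition mu [set: X] P.
Let G := level children P.

Lemma level_admissible n : G n `<=` F.
Proof.
elim: n => [|n IH]; first by rewrite /G level0.
by rewrite /G levelS => B [A GA CB]; exact: (rCZ_children_sub HX (IH _ GA)).
Qed.

Lemma countable_level n : countable (G n).
Proof.
elim: n => [|n IH]; first by rewrite /G level0; case: Pq.
rewrite /G levelS; apply: bigcup_countable => // A GA.
by have [] := rCZ_children_partition HX (level_admissible GA).
Qed.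

Lemma nested_level : nested G.
Proof.
have sub A B : F A -> children A B -> B `<=` A.
  by move=> FA CB; have [_ _ /(_ _ CB)[]] := rCZ_children_partition HX FA.
split=> n; last first.
  move=> B; rewrite /G levelS => -[A GA CB]; exists A => //.
  exact: sub (level_admissible GA) CB.
elim: n => [|n IH]; first by rewrite /G level0; case: Pq.
rewrite /G levelS => B B' [A GA CB] [A' GA' CB'] [x [Bx B'x]].
have AA' : A = A'.
  apply: IH => //; exists x; split.
    exact: sub (level_admissible GA) CB _ Bx.
  exact: sub (level_admissible GA') CB' _ B'x.
have [_ tC _ _] := rCZ_children_partition HX (level_admissible GA).
by rewrite -AA' in CB'; apply: tC => //; exists x.
Qed.

(** A stopped set is not in [P], so it has a parent at the previous level, of
    mean at most [a] and of measure at most [kappa] times its own. *)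
Lemma stopped_mean_le (phi : Borel X -> R) (a : R) :
  (0 <= a)%R -> measurable_fun setT phi -> (forall x, 0 <= phi x)%R ->
  (forall A, P A -> \int[mu]_(x in (A : set (Borel X))) (phi x)%:E <= a%:E * mu A) ->
  forall B, stopped G [set B | a%:E * mu B < \int[mu]_(x in (B : set (Borel X))) (phi x)%:E] B ->
  \int[mu]_(x in (B : set (Borel X))) (phi x)%:E <= (kappa * a)%:E * mu B.
Proof.
move=> a0 mphi phi0 Plight B [[|n] [GB heavyB firstB]].
  move: GB; rewrite /G level0 => /Plight; rewrite leNgt.
  by move: heavyB => /= ->.
move: GB; rewrite /G levelS => -[A GA CB].
have FA := level_admissible GA.
have [_ _ /(_ _ CB)[mB BA] _] := rCZ_children_partition HX FA.
have /negP := firstB n A (ltnSn n) GA BA; rewrite /= -leNgt => lightA.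
apply: (@le_trans _ _ (\int[mu]_(x in (A : set (Borel X))) (phi x)%:E)).
  apply: ge0_subset_integral => //.
  - exact: (rCZ_borel HX).
  - by apply: measurable_funTS; exact/measurable_EFinP.
  - by move=> x _; rewrite lee_fin.
apply: (le_trans lightA); rewrite mulrC EFinM -muleA.
by apply: lee_wpmul2l; [rewrite lee_fin|exact: (rCZ_children_measure HX)].
Qed.

(** A descendant [B] of radius [r] around [x] lies in the ball of centre [x] and
    radius [2 * kappa * r]. *)
Lemma fine_descendants (U : set X) : open U ->
  {ae mu, forall x : Borel X, U x -> exists n B, [/\ G n B, B x & B `<=` U]}.
Proof.
move=> oU; have [cP _ _ [N [mN N0 PN]]] := Pq.
have h : {ae mu, forall x : Borel X, forall A, P A -> forall k : nat, A x ->
    exists B, [/\ descendants children A B, B x & (radius B <= k.+1%:R^-1)%R]}.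
  apply: ae_forall_countable => // A PA; apply/ae_foralln => k.
  by apply: (rCZ_descendants HX); [rewrite invr_gt0|exact: PF].
have hP : {ae mu, forall x : Borel X, exists2 A, P A & A x}.
  by exists N; split => // x /= nx; apply: PN; split.
apply: filterS (filterI hP h) => x [[A PA Ax] /(_ A PA) hx] Ux.
have : nbhs x U by apply: open_nbhs_nbhs.
move=> /nbhs_ballP[e /= e0 eU].
have [k] : exists k, (0 + k.+1%:R^-1 < e / (2 * kappa))%R.
  by apply: ltr_add_invr; rewrite divr_gt0// mulr_gt0.
rewrite add0r ltr_pdivlMr ?mulr_gt0// => ke.
have [B [[n _ CB] Bx rB]] := hx k Ax.
have GB : G n B by exists A.
exists n, B; split => // y By; apply: eU.
have Bball := rCZ_ball HX (level_admissible GB).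
apply: (@le_ball _ _ x (kappa * radius B + kappa * radius B)%R).
  rewrite -mulrDl -mulr2n -mulr_natl mulrC; apply: le_trans (ltW ke).
  by apply: ler_wpM2r => //; rewrite mulr_ge0// ltW.
apply: (@ball_triangle _ _ (centre B)); last exact: Bball.
by apply: ball_sym; exact: Bball.
Qed.

End selection.

Section stopping_family.
Context {R : realType} {X : pointedMetricType R}.
Variable mu : {measure set (Borel X) -> \bar R}.
Local Open Scope ereal_scope.

(** The value [kappa * \int phi / l] at which the quasi-partition is taken makes
    every mean over it at most [a = l / kappa], so that the children can be
    followed down from sets that do not stop. *)
Lemma stopping_family (kappa : R) (F : set (set X)) (centre : set X -> X)
    (radius : set X -> R) (children : set X -> set (set X))
    (phi : Borel X -> R) (l : R) :
  radon mu -> restrictive_CZ_axioms mu kappa F centre radius children ->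
  measurable_fun setT phi -> (forall x, 0 <= phi x)%R ->
  0 < \int[mu]_x (phi x)%:E < +oo -> (0 < l)%R ->
  kappa%:E * \int[mu]_x (phi x)%:E < l%:E * mu [set: X] ->
  exists S : set (set X), [/\ S `<=` F, countable S, trivIset S id,
    forall B, S B ->
      l%:E * mu B <= kappa%:E * \int[mu]_(x in (B : set (Borel X))) (phi x)%:E /\
      \int[mu]_(x in (B : set (Borel X))) (phi x)%:E <= l%:E * mu B &
    {ae mu, forall x, ~ (\bigcup_(B in S) B) x -> (phi x <= l)%R}].
Proof.
move=> Hr HX mphi phi0 /andP[I0 Ioo] l0 hl.
have k1 := rCZ_kappa HX; have k0 : (0 < kappa)%R by exact: lt_le_trans k1.
have mphiE : measurable_fun setT (EFin \o phi) by exact/measurable_EFinP.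
set I := \int[mu]_x (phi x)%:E in I0 Ioo hl.
have [i iE] : exists i : R, I = i%:E by exists (fine I); rewrite fineK// ge0_fin_numE// ltW.
rewrite iE lte_fin in I0.
have s0 : (0 < kappa * i / l)%R by rewrite divr_gt0// mulr_gt0.
have smu : (kappa * i / l)%:E < mu [set: X].
  by rewrite mulrC EFinM lte_pdivrMl// EFinM -iE.
have [P [PF Pq Pl]] := rCZ_partition HX s0 smu.
pose G := level children P.
pose a := (l / kappa)%R.
have a0 : (0 < a)%R by rewrite divr_gt0.
have ka : (kappa * a = l)%R by rewrite /a mulrC divfK// gt_eqF.
pose heavy : set (set X) :=
  [set B | a%:E * mu B < \int[mu]_(x in (B : set (Borel X))) (phi x)%:E].
have mG n (B : set X) : G n B -> measurable (B : set (Borel X)).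
  by move=> GB; apply: (rCZ_borel HX); exact: (level_admissible HX PF GB).
have nG : nested G by exact: (nested_level HX PF Pq).
have cG n : countable (G n) by exact: (countable_level HX PF Pq).
have cS : countable (stopped G heavy) by exact: countable_stopped.
have Plight A : P A -> \int[mu]_(x in (A : set (Borel X))) (phi x)%:E <= a%:E * mu A.
  move=> PA; apply: (@le_trans _ _ I).
    apply: ge0_subset_integral => //; first by apply: (rCZ_borel HX); exact: PF.
    by move=> x _; rewrite lee_fin.
  rewrite iE; have -> : i = (a * (kappa * i / l))%R.
    by rewrite /a; field; rewrite !gt_eqF.
  by rewrite EFinM lee_pmul2l//; apply/ltW/Pl.
have SF : stopped G heavy `<=` F.
  by move=> B [n [GB _ _]]; exact: (level_admissible HX PF GB).
have mZ : measurable (\bigcup_(B in stopped G heavy) (B : set (Borel X))).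
  have [J [e [_ eS]]] := countable_index cS.
  rewrite -eS bigcup_image; apply: countable_bigcupT_measurable => // j.
  by apply: (rCZ_borel HX); apply: SF; rewrite -eS.
exists (stopped G heavy); split => //.
- exact: trivIset_stopped.
- move=> B SB; split.
    have [n [_ /= /ltW hB _]] := SB.
    by rewrite -ka EFinM -muleA lee_pmul2l.
  by rewrite -ka; exact: (stopped_mean_le HX PF (ltW a0) mphi phi0 Plight SB).
- have : {ae mu, forall x,
      ~ (\bigcup_(B in stopped G heavy) (B : set (Borel X))) x -> (phi x <= a)%R}.
    apply: (ae_le_of_light_cover (G := G)) => // U oU.
    apply: filterS (fine_descendants HX PF Pq oU) => x hx Ux Zx.
    have [n [B [GB Bx BU]]] := hx Ux.
    exists n, B; split => //; rewrite leNgt; apply/negP => heavyB.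
    have [B' SB' BB'] := stopped_cover GB (heavyB : heavy B).
    by apply: Zx; exists B' => //; exact: BB'.
  apply: filterS => x h /h /le_trans; apply.
  by rewrite -ka ler_peMl// ltW.
Qed.

End stopping_family.

(** * Moduli and means of complex functions *)

Section modulus.
Context {R : realType}.
Implicit Types z w : R[i].

Lemma normc_sqrtE z : normc z = Num.sqrt (complex.Re z ^+ 2 + complex.Im z ^+ 2).
Proof. by case: z. Qed.

Lemma normc_ge0 z : 0 <= normc z.
Proof. by rewrite normc_sqrtE sqrtr_ge0. Qed.

Lemma normc_Re z : `|complex.Re z| <= normc z.
Proof. by rewrite normc_sqrtE -sqrtr_sqr ler_sqrt ?lerDl ?sqr_ge0// addr_ge0 ?sqr_ge0. Qed.

Lemma normc_Im z : `|complex.Im z| <= normc z.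
Proof. by rewrite normc_sqrtE -sqrtr_sqr ler_sqrt ?lerDr ?sqr_ge0// addr_ge0 ?sqr_ge0. Qed.

Lemma normc_sub z w : normc (z - w) <= normc z + normc w.
Proof. by have := le_normcD (z : Rcomplex R) (- w); rewrite normcN. Qed.

(** Cauchy-Schwarz in the plane, from which the triangle inequality for complex
    integrals is derived. *)
Lemma dot_normc_le a b z :
  a * complex.Re z + b * complex.Im z <= Num.sqrt (a ^+ 2 + b ^+ 2) * normc z.
Proof.
have nn (u v : R) : 0 <= u ^+ 2 + v ^+ 2 by rewrite addr_ge0 ?sqr_ge0.
rewrite normc_sqrtE -sqrtrM//; apply: le_trans (ler_norm _) _.
rewrite -sqrtr_sqr ler_sqrt ?mulr_ge0//.
case: z => x y /=; rewrite -subr_ge0.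
have -> : (a ^+ 2 + b ^+ 2) * (x ^+ 2 + y ^+ 2) - (a * x + b * y) ^+ 2 =
  (a * y - b * x) ^+ 2 by ring.
exact: sqr_ge0.
Qed.

Lemma powRD_le (a b p : R) : 0 <= a -> 0 <= b -> 0 <= p ->
  (a + b) `^ p <= 2 `^ p * (a `^ p + b `^ p).
Proof.
move=> a0 b0 p0; wlog ab : a b a0 b0 / a <= b => [H|].
  have [|/ltW ba] := leP a b; first exact: H.
  by rewrite addrC [X in _ * X]addrC H.
apply: (@le_trans _ _ ((2 * b) `^ p)).
  by apply: ge0_ler_powR; rewrite ?nnegrE ?addr_ge0 ?mulr_ge0//; lra.
by rewrite powRM// ler_wpM2l ?powR_ge0// lerDr powR_ge0.
Qed.

End modulus.

Section complex_integral.
Context d (T : measurableType d) (R : realType).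
Variable mu : {measure set T -> \bar R}.
Implicit Types (f : T -> R[i]) (D : set T).

Definition cmeasurable f :=
  measurable_fun setT (fun x => complex.Re (f x)) /\
  measurable_fun setT (fun x => complex.Im (f x)).

Lemma measurable_normc f : cmeasurable f -> measurable_fun setT (fun x => normc (f x)).
Proof.
move=> [mr mi].
rewrite (_ : (fun x => _) = (fun x => (complex.Re (f x) ^+ 2 + complex.Im (f x) ^+ 2) `^ 2^-1)).
  apply: (measurableT_comp (measurable_powR 2^-1)).
  by apply: measurable_funD; apply: measurable_funX.
by apply/funext => x; rewrite normc_sqrtE powR12_sqrt// addr_ge0 ?sqr_ge0.
Qed.

Lemma cmeasurable_sub f g : cmeasurable f -> cmeasurable g ->
  cmeasurable (fun x => f x - g x).
Proof.
move=> [fr fi] [gr gi]; split.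
- rewrite (_ : (fun x => _) = (fun x => complex.Re (f x) - complex.Re (g x))).
    exact: measurable_funB.
  by apply/funext => x; case: (f x); case: (g x).
- rewrite (_ : (fun x => _) = (fun x => complex.Im (f x) - complex.Im (g x))).
    exact: measurable_funB.
  by apply/funext => x; case: (f x); case: (g x).
Qed.

Definition mean f D : R[i] :=
  Complex (\int[mu]_(x in D) complex.Re (f x) / fine (mu D))
          (\int[mu]_(x in D) complex.Im (f x) / fine (mu D)).

Section on_a_set.
Variables (f : T -> R[i]) (D : set T).
Hypothesis mf : cmeasurable f.
Hypothesis mD : measurable D.
Hypothesis fD : (\int[mu]_(x in D) (normc (f x))%:E < +oo)%E.
Hypothesis muD : (0 < mu D < +oo)%E.

Let muDE : mu D = (fine (mu D))%:E.
Proof. by case/andP: muD => a b; rewrite fineK// ge0_fin_numE// ltW. Qed.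

Let muD0 : 0 < fine (mu D).
Proof. by rewrite -lte_fin -muDE; case/andP: muD. Qed.

Lemma integrable_normc : mu.-integrable D (EFin \o (fun x => normc (f x))).
Proof.
apply/integrableP; split.
  by apply: measurable_funTS; apply/measurable_EFinP; exact: measurable_normc.
by under eq_integral do rewrite /= ger0_norm ?normc_ge0//.
Qed.

Lemma integrable_Re : mu.-integrable D (EFin \o (fun x => complex.Re (f x))).
Proof.
apply: le_integrable integrable_normc => //.
  by apply: measurable_funTS; apply/measurable_EFinP; case: mf.
by move=> x _; rewrite /= lee_fin (ger0_norm (normc_ge0 _)) normc_Re.
Qed.

Lemma integrable_Im : mu.-integrable D (EFin \o (fun x => complex.Im (f x))).
Proof.
apply: le_integrable integrable_normc => //.
  by apply: measurable_funTS; apply/measurable_EFinP; case: mf.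
by move=> x _; rewrite /= lee_fin (ger0_norm (normc_ge0 _)) normc_Im.
Qed.

(** If [(a, b)] are the integrals of the two parts of [f] and [r] is its modulus,
    then [r ^+ 2] is the integral of [a * Re f + b * Im f], which is at most [r]
    times the integral of [|f|]. *)
Lemma normc_mean_le : ((normc (mean f D))%:E * mu D <= \int[mu]_(x in D) (normc (f x))%:E)%E.
Proof.
rewrite -(fineK (integrable_fin_num mD integrable_normc)) muDE -EFinM lee_fin.
rewrite -[X in _ <= X]/(\int[mu]_(x in D) normc (f x)).
set n := \int[mu]_(x in D) _.
rewrite normc_sqrtE /=.
set a := \int[mu]_(x in D) _; set b := \int[mu]_(x in D) _.
set m := fine (mu D); have m0 : 0 < m by exact: muD0.
rewrite !expr_div_n -mulrDl sqrtrM ?addr_ge0 ?sqr_ge0// sqrtrV ?sqr_ge0//.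
rewrite sqrtr_sqr gtr0_norm// divfK ?gt_eqF//.
set r := Num.sqrt _.
have r0 : 0 <= r by exact: sqrtr_ge0.
have n0 : 0 <= n by apply: Rintegral_ge0 => x _; exact: normc_ge0.
have rn : r ^+ 2 <= r * n.
  rewrite sqr_sqrtr ?addr_ge0 ?sqr_ge0// !expr2.
  rewrite -(RintegralZl _ mD integrable_Re) -(RintegralZl _ mD integrable_Im).
  have iRe : mu.-integrable D (EFin \o (fun x => a * complex.Re (f x))).
    exact: integrableZl integrable_Re.
  have iIm : mu.-integrable D (EFin \o (fun x => b * complex.Im (f x))).
    exact: integrableZl integrable_Im.
  rewrite -RintegralD// -(RintegralZl _ mD integrable_normc).
  apply: le_Rintegral => //.
  - exact: integrableD iRe iIm.
  - exact: integrableZl integrable_normc.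
  - by move=> x _; exact: dot_normc_le.
have [->//|rN0] := eqVneq r 0.
by rewrite expr2 ler_pM2l// lt_def rN0 in rn.
Qed.

Lemma integral_sub_mean :
  (\int[mu]_(x in D) (complex.Re (f x - mean f D))%:E = 0 /\
   \int[mu]_(x in D) (complex.Im (f x - mean f D))%:E = 0)%E.
Proof.
have ic (c : R) : mu.-integrable D (EFin \o cst c).
  apply/integrableP; split; first by apply/measurable_EFinP; exact: measurable_cst.
  by rewrite /= integral_cst// muDE -EFinM ltry.
have key (h : T -> R) : mu.-integrable D (EFin \o h) ->
    (\int[mu]_(x in D) (h x - (\int[mu]_(x in D) h x)%R / fine (mu D))%:E = 0)%E.
  move=> ih; set c := (_ / _)%R; under eq_integral do rewrite EFinB.
  rewrite integralB_EFin//; last exact: ic.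
  have -> : (\int[mu]_(x in D) c%:E = c%:E * mu D)%E by exact: integral_cst.
  rewrite muDE -EFinM /c divfK ?gt_eqF// fineK ?subee//; exact: integrable_fin_num.
split.
- rewrite -[RHS](key _ integrable_Re); apply: eq_integral => x _.
  by congr EFin; case: (f x).
- rewrite -[RHS](key _ integrable_Im); apply: eq_integral => x _.
  by congr EFin; case: (f x).
Qed.

Lemma integral_normc_sub_mean_le :
  (\int[mu]_(x in D) (normc (f x - mean f D))%:E <=
   \int[mu]_(x in D) (2 * normc (f x))%:E)%E.
Proof.
have mn : measurable_fun D (fun x => (normc (f x))%:E).
  by apply: measurable_funTS; apply/measurable_EFinP; exact: measurable_normc.
apply: (@le_trans _ _ (\int[mu]_(x in D) ((normc (f x))%:E + (normc (mean f D))%:E))%E).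
  apply: ge0_le_integral => //.
  - by move=> x _; rewrite lee_fin normc_ge0.
  - apply: measurable_funTS; apply/measurable_EFinP; apply: measurable_normc.
    by apply: cmeasurable_sub => //; split; exact: measurable_cst.
  - exact: emeasurable_funD.
  - by move=> x _; rewrite -EFinD lee_fin normc_sub.
rewrite ge0_integralD//; last 2 first.
- by move=> x _; rewrite lee_fin normc_ge0.
- by move=> x _; rewrite lee_fin normc_ge0.
rewrite integral_cst//.
under [leRHS]eq_integral do rewrite mulr_natl mulr2n EFinD.
rewrite ge0_integralD//; last 2 first.
- by move=> x _; rewrite lee_fin normc_ge0.
- by move=> x _; rewrite lee_fin normc_ge0.
by rewrite leeD2l// normc_mean_le.
Qed.

End on_a_set.

End complex_integral.

(** * Tails of sums over disjoint sets *)

Section tail.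
Context d (T : measurableType d) (R : realType).
Variable mu : {measure set T -> \bar R}.
Local Open Scope ereal_scope.

Lemma cvge0_near (I : Type) (F : set_system I) (u : I -> \bar R) : Filter F ->
  (forall i, 0 <= u i) ->
  (forall e : R, (0 < e)%R -> \forall i \near F, u i <= e%:E) ->
  u @ F --> 0.
Proof.
move=> FF u0 h; apply/fine_cvgP; split.
  by apply: filterS (h 1%R ltr01) => i ui; rewrite ge0_fin_numE// (le_lt_trans ui)// ltry.
apply/cvgr0Pnorm_le => e e0; apply: filterS (h e e0) => i ui.
have uf : u i \is a fin_num by rewrite ge0_fin_numE// (le_lt_trans ui)// ltry.
by rewrite /= ger0_norm ?fine_ge0// -lee_fin fineK.
Qed.

(** The integral of [w] is the unordered sum of its integrals over the sets
    [A i], so a finite set of indices carries all but [e] of it. *)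
Lemma integral_tail_small (I : countType) (A : I -> set T) (w : T -> R) :
  (forall i, measurable (A i)) -> trivIset setT A ->
  measurable_fun setT w -> (forall x, 0 <= w x)%R ->
  (forall x, ~ (\bigcup_i A i) x -> w x = 0%R) ->
  \int[mu]_x (w x)%:E < +oo ->
  forall e : R, (0 < e)%R -> \forall J \near @totally I,
    \int[mu]_(x in ~` \bigcup_(i in [set` J]) A i) (w x)%:E <= e%:E.
Proof.
move=> mA tA mw w0 woff woo.
have mwE : measurable_fun setT (EFin \o w) by exact/measurable_EFinP.
have mJ (J : {fset I}) : measurable (\bigcup_(i in [set` J]) A i).
  exact: fin_bigcup_measurable.
pose nu B : \bar R := \int[mu]_(x in B) (w x)%:E.
have nu0 B : 0 <= nu B by apply: integral_ge0 => x _; rewrite lee_fin.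
have nuD (J : {fset I}) :
    nu setT = nu (\bigcup_(i in [set` J]) A i) + nu (~` \bigcup_(i in [set` J]) A i).
  rewrite /nu -(setUv (\bigcup_(i in [set` J]) A i)) ge0_integral_setU//.
  - exact: measurableC (mJ J).
  - exact: measurable_funTS.
  - by move=> x _; rewrite lee_fin.
  - exact/disj_setPCl.
have mU : measurable (\bigcup_i A i) by exact: countable_bigcupT_measurable.
have nuE : nu setT = \esum_(i in setT) nu (A i).
  rewrite -integral_bigcup_esum// /nu [RHS]integral_mkcond.
  apply: eq_integral => x _; rewrite patchE; case: ifPn => // /negP xU.
  by rewrite woff// => Ux; apply: xU; exact: mem_set.
have nu_fin : nu setT \is a fin_num by rewrite ge0_fin_numE.
move=> e e0.
have : nu setT - e%:E < nu setT by rewrite lteBlDr// lteDl// lte_fin.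
rewrite {2}nuE => /ereal_sup_gt[_ [D [finD _] <-]] De.
exists (fset_set D) => // J DJ.
have nuJ : nu setT - e%:E <= nu (\bigcup_(i in [set` J]) A i).
  apply: (le_trans (ltW De)); rewrite fsbig_finite //=.
  rewrite -ge0_integral_bigsetU//.
  - rewrite -bigcup_fset; apply: ge0_subset_integral => //.
    + exact: measurable_funTS.
    + by move=> x _; rewrite lee_fin.
    + by move=> x [i /= iD Ax]; exists i => //=; exact: fsubsetP DJ _ iD.
  - exact: fset_uniq.
  - exact: sub_trivIset tA.
  - exact: measurable_funTS.
  - by move=> x _; rewrite lee_fin.
have nuJ_fin : nu (\bigcup_(i in [set` J]) A i) \is a fin_num.
  rewrite ge0_fin_numE//; apply: le_lt_trans woo.
  by apply: ge0_subset_integral => // x _; rewrite lee_fin.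
by rewrite -/(nu _) -(leeD2lE _ _ nuJ_fin) -nuD -leeBlDr.
Qed.

End tail.

(** * Good and bad parts *)

Section good_bad.
Context d (T : measurableType d) (R : realType).
Variable mu : {measure set T -> \bar R}.
Variables (I : countType) (A : I -> set T) (f : T -> R[i]).
Hypothesis mA : forall i, measurable (A i).
Hypothesis tA : trivIset setT A.
Hypothesis mf : cmeasurable f.
Let U := \bigcup_i A i.

Definition good (x : T) : R[i] :=
  if pselect (exists i, A i x) is left e then mean mu f (A (projT1 (cid e))) else f x.

Definition bad (i : I) (x : T) : R[i] := if x \in A i then f x - good x else 0.

Lemma piece_uniq i j x : A i x -> A j x -> i = j.
Proof. by move=> Ai Aj; apply: tA => //; exists x. Qed.

Lemma goodE i x : A i x -> good x = mean mu f (A i).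
Proof.
move=> Ax; rewrite /good; case: pselect => [e|[]]; last by exists i.
by rewrite (piece_uniq Ax (projT2 (cid e))).
Qed.

Lemma good_off x : ~ U x -> good x = f x.
Proof.
by move=> Ux; rewrite /good; case: pselect => // -[i Ax]; case: Ux; exists i.
Qed.

Lemma measurable_bigcupA : measurable U.
Proof. exact: countable_bigcupT_measurable. Qed.

(** The preimage of a set under a function that is constant on each piece is,
    inside the pieces, a countable union of pieces. *)
Lemma measurable_pieces (h g : T -> R) (c : I -> R) :
  measurable_fun setT h -> (forall i x, A i x -> g x = c i) ->
  (forall x, ~ U x -> g x = h x) -> measurable_fun setT g.
Proof.
move=> mh gA gU _ B mB; rewrite setTI.
have -> : g @^-1` B =
    (h @^-1` B `&` ~` U) `|` \bigcup_i (if `[< B (c i) >] then A i else set0).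
  apply/seteqP; split=> [x /= Bgx|x [[/= Bhx /gU ->]//|[i _]]].
    have [[i _ Ax]|Ux] := pselect (U x); last by left; split; rewrite // -gU.
    by right; exists i => //; rewrite ifT//; apply/asboolP; rewrite -(gA i x).
  by case: ifPn => // /asboolP Bc Ax /=; rewrite (gA i).
apply: measurableU.
  apply: measurableI; last exact: measurableC measurable_bigcupA.
  by rewrite -[X in measurable X]setTI; exact: mh.
by apply: countable_bigcupT_measurable => // i; case: ifPn.
Qed.

Lemma cmeasurable_good : cmeasurable good.
Proof.
case: mf => mr mi; split.
- apply: (@measurable_pieces _ _ (fun i => complex.Re (mean mu f (A i))) mr).
    by move=> i x Ax; rewrite (goodE Ax).
  by move=> x Ux; rewrite good_off.
- apply: (@measurable_pieces _ _ (fun i => complex.Im (mean mu f (A i))) mi).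
    by move=> i x Ax; rewrite (goodE Ax).
  by move=> x Ux; rewrite good_off.
Qed.

Lemma cmeasurable_bad i : cmeasurable (bad i).
Proof.
have [mr mi] := cmeasurable_sub mf cmeasurable_good.
have mb : measurable_fun setT (fun x => x \in A i).
  by apply: (measurable_fun_bool true); rewrite setTI (_ : _ @^-1` _ = A i)//;
     apply/seteqP; split => x /=; [exact: set_mem|exact: mem_set].
split.
- rewrite (_ : (fun x => _) = (fun x => if x \in A i then complex.Re (f x - good x) else 0)).
    by apply: measurable_fun_ifT.
  by apply/funext => x; rewrite /bad; case: ifP.
- rewrite (_ : (fun x => _) = (fun x => if x \in A i then complex.Im (f x - good x) else 0)).
    by apply: measurable_fun_ifT.
  by apply/funext => x; rewrite /bad; case: ifP.
Qed.

Lemma bad_off i x : ~ A i x -> bad i x = 0.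
Proof. by move=> Ax; rewrite /bad ifN//; apply/negP; rewrite inE. Qed.

Lemma error_in (J : {fset I}) i x : A i x -> i \in J ->
  f x - (good x + \sum_(j <- J) bad j x) = 0.
Proof.
move=> Ax iJ; rewrite (big_fsetD1 i iJ)/= big1_seq ?addr0.
  by rewrite /bad ifT; [rewrite addrCA subrr addr0 subrr|exact: mem_set].
move=> j /andP[_]; rewrite in_fsetD1 => /andP[ji _]; apply: bad_off => Aj.
by move: ji; rewrite (piece_uniq Ax Aj) eqxx.
Qed.

Lemma error_off (J : {fset I}) x : ~ (\bigcup_(i in [set` J]) A i) x ->
  f x - (good x + \sum_(j <- J) bad j x) = f x - good x.
Proof.
move=> Jx; rewrite big1_seq ?addr0// => j /andP[_ jJ]; apply: bad_off => Aj.
by apply: Jx; exists j.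
Qed.

End good_bad.

(** * Integrability of the good part and of the error *)

Section Lp.
Context d (T : measurableType d) (R : realType).
Variable mu : {measure set T -> \bar R}.
Implicit Types (f : T -> R[i]).
Local Open Scope ereal_scope.

Lemma Lnorm_normcE f (p : R) :
  Lnorm mu p%:E (fun x => (normc (f x))%:E) = (\int[mu]_x (normc (f x) `^ p)%:E) `^ p^-1.
Proof.
rewrite unlock; congr (_ `^ _); apply: eq_integral => x _.
by rewrite /= ger0_norm// normc_ge0.
Qed.

Lemma Lnorm_normc_lty f (p : R) : (1 <= p)%R ->
  (Lnorm mu p%:E (fun x => (normc (f x))%:E) < +oo) <->
  (\int[mu]_x (normc (f x) `^ p)%:E < +oo).
Proof.
move=> p1; have p0 : (0 < p)%R by exact: lt_le_trans p1.
split=> [|h]; last by rewrite Lnorm_normcE poweR_lty.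
move=> /poweR_lty-/(_ p); rewrite poweR_Lnorm ?gt_eqF//.
by under eq_integral do rewrite /= ger0_norm ?normc_ge0//.
Qed.

Lemma measurable_normc_powR f (p : R) : cmeasurable f ->
  measurable_fun setT (fun x => (normc (f x) `^ p)%:E).
Proof.
move=> mf; apply/measurable_EFinP.
exact: (measurableT_comp (measurable_powR p) (measurable_normc mf)).
Qed.

Section good_Lp.
Variables (I : countType) (A : I -> set T) (f : T -> R[i]) (l p : R).
Hypothesis mA : forall i, measurable (A i).
Hypothesis tA : trivIset setT A.
Hypothesis mf : cmeasurable f.
Hypothesis f1 : \int[mu]_x (normc (f x))%:E < +oo.
Hypothesis muA : forall i, 0 < mu (A i) < +oo.
Hypothesis fA : forall i, \int[mu]_(x in A i) (normc (f x))%:E <= l%:E * mu (A i).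
Let U := \bigcup_i A i.
Let g := good mu A f.

Lemma integral_normc_lty D : measurable D -> \int[mu]_(x in D) (normc (f x))%:E < +oo.
Proof.
move=> mD; apply: le_lt_trans f1; apply: ge0_subset_integral => //.
- by apply/measurable_EFinP; exact: measurable_normc.
- by move=> x _; rewrite lee_fin normc_ge0.
Qed.

Lemma normc_good_le x : U x -> (normc (g x) <= l)%R.
Proof.
move=> [i _ Ax]; rewrite /g (goodE mu f tA Ax).
have := le_trans (normc_mean_le mf (mA i) (integral_normc_lty (mA i)) (muA i)) (fA i).
case/andP: (muA i) => mu0 muoo.
have -> : mu (A i) = (fine (mu (A i)))%:E by rewrite fineK// ge0_fin_numE// ltW.
by rewrite -!EFinM lee_fin ler_pM2r// fine_gt0// mu0.
Qed.

Hypothesis muU : mu U < +oo.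
Hypothesis p1 : (1 <= p)%R.
Hypothesis fp : \int[mu]_x (normc (f x) `^ p)%:E < +oo.

Let p0 : (0 < p)%R. Proof. exact: lt_le_trans p1. Qed.
Let mU : measurable U. Proof. exact: measurable_bigcupA. Qed.

(** Up to the factor [2 `^ p], [psi] dominates the [p]-th powers of both [|g|]
    and [|f - g|]. *)
Let psi x : R := (normc (f x) `^ p + l `^ p * \1_U x)%R.

Let mf_powR : measurable_fun setT (fun x => normc (f x) `^ p)%R.
Proof. exact/measurable_EFinP/measurable_normc_powR. Qed.

Let mU_powR : measurable_fun setT (fun x => l `^ p * \1_U x)%R.
Proof. by apply: measurable_funM => //; exact: measurable_indic. Qed.

Let measurable_psi (c : R) : measurable_fun setT (fun x => (c * psi x)%:E).
Proof.
apply/measurable_EFinP; apply: measurable_funM => //.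
exact: measurable_funD.
Qed.

Let psi_lty (c : R) : (0 <= c)%R -> \int[mu]_x (c * psi x)%:E < +oo.
Proof.
move=> c0; under eq_integral do rewrite EFinM.
have m1 := mf_powR; have m2 := mU_powR.
have g1 x : 0 <= (normc (f x) `^ p)%:E by rewrite lee_fin powR_ge0.
have g2 x : 0 <= (l `^ p * \1_U x)%:E by rewrite lee_fin mulr_ge0// powR_ge0.
rewrite ge0_integralZl//; last 2 first.
- by apply/measurable_EFinP; exact: measurable_funD.
- by move=> x _; rewrite EFinD adde_ge0.
rewrite lte_mul_pinfty ?lee_fin//.
under eq_integral do rewrite EFinD.
rewrite ge0_integralD//; last 2 first.
- exact/measurable_EFinP.
- exact/measurable_EFinP.
apply: lte_add_pinfty => //.
under eq_integral do rewrite EFinM.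
rewrite ge0_integralZl//; last by rewrite lee_fin powR_ge0.
- by rewrite integral_indic// setIT lte_mul_pinfty// lee_fin powR_ge0.
- by apply/measurable_EFinP; exact: measurable_indic.
Qed.

Lemma good_Lp : \int[mu]_x (normc (g x) `^ p)%:E < +oo.
Proof.
apply: le_lt_trans (psi_lty ler01); apply: ge0_le_integral => //.
- by move=> x _; rewrite lee_fin powR_ge0.
- exact: measurable_normc_powR (cmeasurable_good _ mA tA mf).
- move=> x _; rewrite lee_fin mul1r /psi indicE.
  have [Ux|Ux] := pselect (U x).
    rewrite mem_set// mulr1; apply: (@le_trans _ _ (l `^ p)%R).
      have gl := normc_good_le Ux.
      by apply: ge0_ler_powR; rewrite ?nnegrE ?normc_ge0// ?(le_trans _ gl) ?normc_ge0// ltW.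
    by rewrite lerDr powR_ge0.
  by rewrite /g good_off// memNset// mulr0 addr0.
Qed.

Lemma sub_good_Lp : \int[mu]_x (normc (f x - g x) `^ p)%:E < +oo.
Proof.
apply: le_lt_trans (psi_lty (powR_ge0 2 p)); apply: ge0_le_integral => //.
- by move=> x _; rewrite lee_fin powR_ge0.
- exact: measurable_normc_powR (cmeasurable_sub mf (cmeasurable_good _ mA tA mf)).
- move=> x _; rewrite lee_fin /psi indicE.
  have [Ux|Ux] := pselect (U x); last first.
    rewrite /g good_off// subrr Normc.normc0 powR0 ?gt_eqF//.
    by rewrite mulr_ge0 ?powR_ge0// addr_ge0 ?powR_ge0// mulr_ge0// powR_ge0.
  have gl := normc_good_le Ux.
  have l0 : (0 <= l)%R by exact: le_trans (normc_ge0 _) gl.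
  rewrite mem_set// mulr1; apply: le_trans (powRD_le (normc_ge0 _) l0 (ltW p0)).
  apply: ge0_ler_powR; rewrite ?nnegrE ?addr_ge0 ?normc_ge0//; first exact: ltW.
  by apply: le_trans (normc_sub _ _) _; rewrite lerD2l.
Qed.

End good_Lp.

End Lp.

(** * The decomposition *)

Section decomposition.
Context {R : realType} {X : pointedMetricType R}.
Variable mu : {measure set (Borel X) -> \bar R}.
Local Open Scope ereal_scope.

(** Everything but the choice of the stopped sets: a countable disjoint family
    with means between [l / kappa] and [l], off which [|f| <= l], yields the
    decomposition. *)
Lemma CZ_decomposition_of_family (kappa : R) (F S : set (set X)) (f : X -> R[i]) (l : R) :
  (1 <= kappa)%R -> (0 < l)%R -> in_Lp mu 1 f -> S `<=` F -> countable S ->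
  trivIset S id -> (forall B, S B -> measurable (B : set (Borel X))) ->
  (forall B, S B -> 0 < mu B < +oo) ->
  (forall B, S B ->
    l%:E * mu B <= kappa%:E * \int[mu]_(x in (B : set (Borel X))) (normc (f x))%:E /\
    \int[mu]_(x in (B : set (Borel X))) (normc (f x))%:E <= l%:E * mu B) ->
  {ae mu, forall x : Borel X, ~ (\bigcup_(B in S) B) x -> (normc (f x) <= l)%R} ->
  CZ_decomposition mu kappa F f l.
Proof.
move=> k1 l0 [fr fi f1] SF cS tS mS muS Sl Soff.
have k0 : (0 < kappa)%R by exact: lt_le_trans k1.
have mf : @cmeasurable _ (Borel X) _ f by split.
have mn := measurable_normc mf.
have mnE : measurable_fun setT (fun x : Borel X => (normc (f x))%:E) by exact/measurable_EFinP.
have {}f1 : \int[mu]_x (normc (f x))%:E < +oo.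
  by move: f1; rewrite /Lpnorm Lnorm1; under eq_integral do rewrite gee0_abs ?lee_fin ?normc_ge0//.
have f1E : Lpnorm mu 1 f = \int[mu]_x (normc (f x))%:E.
  by rewrite /Lpnorm Lnorm1; apply: eq_integral => x _; rewrite gee0_abs ?lee_fin ?normc_ge0.
have [I [A [Ainj ArngS]]] := countable_index cS.
have SA i : S (A i) by rewrite -ArngS.
pose A' : I -> set (Borel X) := A.
have mA i : measurable (A' i) by exact: mS.
have tA : trivIset setT A' by move=> i j _ _ ij; apply: Ainj; exact: tS ij.
have muA i : 0 < mu (A' i) < +oo by exact: muS.
have fA i : \int[mu]_(x in A' i) (normc (f x))%:E <= l%:E * mu (A' i) by have [] := Sl _ (SA i).
have UE : \bigcup_(B in S) B = \bigcup_i A' i by rewrite -ArngS bigcup_image.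
have mU : measurable (\bigcup_i A' i) by exact: measurable_bigcupA.
pose g := good mu A' f; pose b := bad mu A' f.
have intc (c : R) : (0 <= c)%R ->
    \esum_(i in [set: I]) \int[mu]_(x in A' i) (c * normc (f x))%:E <= c%:E * Lpnorm mu 1 f.
  move=> c0; have mc : measurable_fun setT (fun x : Borel X => (c * normc (f x))%:E).
    by apply/measurable_EFinP; exact: measurable_funM.
  have c_ge0 (x : X) : 0 <= (c * normc (f x))%:E by rewrite lee_fin mulr_ge0// normc_ge0.
  rewrite -integral_bigcup_esum// f1E -ge0_integralZl//; last first.
  - by move=> x _; rewrite lee_fin normc_ge0.
  under [leRHS]eq_integral do rewrite -EFinM.
  by apply: ge0_subset_integral.
have summu : \esum_(i in [set: I]) mu (A' i) <= kappa%:E * Lpnorm mu 1 f / l%:E.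
  apply: (@le_trans _ _ ((kappa / l)%:E * Lpnorm mu 1 f)); last first.
    by rewrite inver gt_eqF// muleAC -EFinM.
  apply: le_trans (intc _ _); last by rewrite divr_ge0// ltW.
  apply: le_esum => i _; under eq_integral do rewrite EFinM.
  rewrite ge0_integralZl//; last 3 first.
  - exact: measurable_funTS.
  - by move=> x _; rewrite lee_fin normc_ge0.
  - by rewrite lee_fin divr_ge0// ltW.
  rewrite mulrC EFinM -muleA lee_pdivlMl//; exact: (Sl _ (SA i)).1.
have muU : mu (\bigcup_i A' i) < +oo.
  have -> : mu (\bigcup_i A' i) = \esum_(i in [set: I]) mu (A' i).
    rewrite -[LHS]mul1e -integral_cst// integral_bigcup_esum//.
    by apply: eq_esum => i _; rewrite integral_cst// mul1e.
  apply: le_lt_trans summu _; rewrite f1E inver gt_eqF//.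
  rewrite muleC lte_mul_pinfty ?lee_fin ?invr_ge0 ?(ltW l0)//.
  by rewrite lte_mul_pinfty ?lee_fin ?(ltW k0).
have bnorm i x : (normc (b i x) =
    if x \in A' i then normc (f x - mean mu f (A' i)) else 0)%R.
  rewrite /b /bad; case: ifPn => [/set_mem Ax|_]; last by rewrite Normc.normc0.
  by rewrite (goodE _ _ tA Ax).
have cvx (x : X) : (normc (sum_error f g b J x) @[J --> @totally I] --> (0 : R))%R.
  apply/cvgr0Pnorm_le => e e0.
  have [[i _ Ax]|Ux] := pselect ((\bigcup_i A' i) x).
    exists [fset i]%fset => // J /= iJ.
    rewrite /sum_error (error_in mu f tA Ax) ?Normc.normc0 ?normr0 ?ltW//.
    by apply: (fsubsetP iJ); rewrite in_fset1.
  apply: nearW => J; rewrite /sum_error error_off.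
    by rewrite /g good_off// subrr Normc.normc0 normr0 ltW.
  by move=> [i _ Ax]; apply: Ux; exists i.
exists I, g, b, A; split.
- exists set0; split; [exact: measurable0|exact: measure0|].
  move=> x /=; apply; exact: cvx.
- rewrite /Lpnorm unlock; case: ifPn => _; last by rewrite lee_fin ltW.
  apply/ess_supP; apply: filterS Soff => x fx.
  rewrite /= lee_fin ger0_norm ?normc_ge0//.
  have [Ux|Ux] := pselect ((\bigcup_i A' i) x).
    exact: (normc_good_le mA tA mf f1 muA fA).
  by rewrite /g good_off//; apply: fx; rewrite UE.
- split=> [i|].
    have [ir ii] := integral_sub_mean mf (mA i) (integral_normc_lty mf f1 (mA i)) (muA i).
    split; [rewrite -[RHS]ir|rewrite -[RHS]ii]; rewrite [RHS]integral_mkcond;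
      apply: eq_integral => x _; rewrite patchE /b /bad;
      by case: ifPn => // /set_mem Ax; rewrite (goodE _ _ tA Ax).
  apply: (@le_trans _ _ (2%:E * Lpnorm mu 1 f)); last first.
    apply: lee_wpmul2r; first by rewrite f1E integral_ge0// => x _; rewrite lee_fin normc_ge0.
    by rewrite lee_fin ler_peMr.
  apply: le_trans (intc 2%R _) => //; apply: le_esum => i _.
  apply: le_trans (integral_normc_sub_mean_le mf (mA i) (integral_normc_lty mf f1 (mA i)) (muA i)).
  rewrite /Lpnorm Lnorm1 [leRHS]integral_mkcond le_eqVlt; apply/orP; left; apply/eqP.
  apply: eq_integral => x _; rewrite gee0_abs ?lee_fin ?normc_ge0// bnorm !patchE.
  by case: ifP.
- split=> [i|i x Ax|//]; [exact: SF|exact: bad_off].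
- move=> p p1 [_ _ /(Lnorm_normc_lty mu f p1) fp].
  have p0 : (0 < p)%R by exact: lt_le_trans p1.
  have fgp := sub_good_Lp mA tA mf f1 muA fA muU p1 fp.
  have mg := cmeasurable_good mu mA tA mf.
  have mfg := measurable_normc_powR p (cmeasurable_sub mf mg).
  split.
  + case: mg => gr gi; split => //; apply/(Lnorm_normc_lty _ _ p1).
    exact: good_Lp mA tA mf f1 muA fA muU p1 fp.
  + move=> i; have mb := cmeasurable_bad mu mA tA mf i; case: (mb) => br bi; split => //.
    apply/(Lnorm_normc_lty _ _ p1); apply: le_lt_trans fgp; apply: ge0_le_integral => //.
    * by move=> x _; rewrite lee_fin powR_ge0.
    * exact: measurable_normc_powR.
    * move=> x _; rewrite lee_fin /b /bad; case: ifP => // _.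
      by rewrite Normc.normc0 powR0 ?gt_eqF// powR_ge0.
  + apply: cvge0_near => [J|e e0]; first exact: Lnorm_ge0.
    have woff x : ~ (\bigcup_i A' i) x -> (normc (f x - g x) `^ p = 0)%R.
      by move=> Ux; rewrite /g good_off// subrr Normc.normc0 powR0// gt_eqF.
    have ep0 : (0 < e `^ p)%R by exact: powR_gt0.
    have mw : measurable_fun setT (fun x : Borel X => normc (f x - g x) `^ p)%R.
      exact/measurable_EFinP.
    have := integral_tail_small mA tA mw (fun x => powR_ge0 _ _) woff fgp ep0.
    apply: filterS => J hJ; rewrite /Lpnorm Lnorm_normcE.
    have -> : \int[mu]_x (normc (sum_error f g b J x) `^ p)%:E =
        \int[mu]_(x in ~` \bigcup_(i in [set` J]) A' i) (normc (f x - g x) `^ p)%:E.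
      rewrite [RHS]integral_mkcond; apply: eq_integral => x _; rewrite patchE.
      have [[i iJ Ax]|Jx] := pselect ((\bigcup_(i in [set` J]) A' i) x).
        rewrite memNset; last by apply; exists i.
        by rewrite /sum_error (error_in mu f tA Ax iJ) Normc.normc0 powR0 ?gt_eqF.
      by rewrite mem_set// /sum_error error_off.
    have -> : e%:E = (e `^ p)%:E `^ p^-1.
      by rewrite poweR_EFin -powRrM divff ?gt_eqF// powRr1// ltW.
    apply: gt0_ler_poweR => //; first by rewrite invr_ge0 ltW.
      by rewrite in_itv/= leey andbT integral_ge0// => x _; rewrite lee_fin powR_ge0.
    by rewrite in_itv/= leey andbT lee_fin powR_ge0.
Qed.
(** For [x = 0] the hypothesis [a / x < l] fails, as [0^-1 = +oo], and for
    [x = +oo] it says that [0 < l]. *)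
Lemma lte_mul_of_lte_div (a x : \bar R) (l : R) :
  0 < a < +oo -> 0 <= x -> a / x < l%:E -> a < l%:E * x.
Proof.
case: a => [a| |]; rewrite ?ltxx ?andbF ?ltNye// lte_fin => /andP[a0 _].
case: x => [x| |]//; last first.
  by rewrite invey mule0 lte_fin => _ l0; rewrite gt0_muley ?lte_fin// ltry.
rewrite lee_fin le_eqVlt => /predU1P[<-|x0].
  by rewrite inve0 gt0_muley ?lte_fin.
by rewrite inver gt_eqF// lte_pdivrMr.
Qed.

(** The zero function is treated apart, with an empty family of stopped sets: the
    quasi-partition of [X] exists only at positive values. *)
Lemma decomposition_of_restrictive (kappa : R) (F : set (set X)) (centre : set X -> X)
    (radius : set X -> R) (children : set X -> set (set X)) (f : X -> R[i]) (l : R) :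
  radon mu -> restrictive_CZ_axioms mu kappa F centre radius children ->
  in_Lp mu 1 f -> kappa%:E * Lpnorm mu 1 f / mu [set: X] < l%:E ->
  CZ_decomposition mu kappa F f l.
Proof.
move=> Hr HX f1 hl; have [fr fi foo] := f1.
have k1 := rCZ_kappa HX; have k0 : (0 < kappa)%R by exact: lt_le_trans k1.
have mf : @cmeasurable _ (Borel X) _ f by split.
have mn := measurable_normc mf.
have f1E : Lpnorm mu 1 f = \int[mu]_x (normc (f x))%:E.
  by rewrite /Lpnorm Lnorm1; apply: eq_integral => x _; rewrite gee0_abs ?lee_fin ?normc_ge0.
have f_ge0 : 0 <= Lpnorm mu 1 f by exact: Lnorm_ge0.
have l0 : (0 < l)%R.
  rewrite -lte_fin; apply: le_lt_trans hl.
  by rewrite !mule_ge0 ?inve_ge0// lee_fin ltW.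
have [fz|fN0] := eqVneq (Lpnorm mu 1 f) 0.
  apply: (CZ_decomposition_of_family (S := set0)) => //.
  have : ae_eq mu setT (fun x : Borel X => (normc (f x))%:E) (cst 0).
    apply/ae_eq_integral_abs => //; first exact/measurable_EFinP.
    by rewrite -fz /Lpnorm Lnorm1.
  by apply: filterS => x /(_ I) [->] _; exact: ltW.
have fpos : 0 < Lpnorm mu 1 f by rewrite lt0e fN0.
have [] := @stopping_family _ _ mu kappa F centre radius children
  (fun x : Borel X => normc (f x)) l Hr HX mn (fun x => normc_ge0 _) _ l0 _.
- by rewrite -f1E fpos.
- rewrite -f1E; apply: lte_mul_of_lte_div => //.
  by rewrite mule_gt0//= lte_mul_pinfty ?lee_fin ?(ltW k0)// ge0_fin_numE.
move=> S [SF cS tS Sl Soff].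
apply: CZ_decomposition_of_family Soff => //.
- by move=> B /SF; exact: (rCZ_borel HX).
- by move=> B /SF FB; rewrite (admissible_gt0 HX FB) (admissible_fin HX FB).
Qed.

End decomposition.

Theorem proposition3p5 (R : realType) (X : pointedMetricType R)
    (mu : {measure set (Borel X) -> \bar R}) :
  restrictive_CZ_space mu -> CZ_space mu.
Proof.
move=> [Hr [kappa [F [centre [radius [children HX]]]]]]; split => //.
exists kappa, F, centre, radius; split.
- exact: (rCZ_kappa HX).
- exact: (rCZ_borel HX).
- exact: (rCZ_radius HX).
- exact: (rCZ_ball HX).
- by move=> A /(rCZ_doubling HX)[].
- by move=> f l; exact: decomposition_of_restrictive Hr HX.
Qed.
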